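(* Let $V$ be a finite dataset, $\mathrm{sim}$ a symmetric real-valued similarity function, $q$ a query vector, $\epsilon\in\mathbb{R}$ a similarity threshold, and $k\ge1$ an integer. Let $C_K=\{r_1,\dots,r_K\}\subseteq V$ be the $K$ nearest neighbors of $q$ in $V$, arranged in descending order of similarity scores $s_1\ge s_2\ge\dots\ge s_K$, where $s_i=\mathrm{sim}(r_i,q)$ (so every $u\in V\setminus C_K$ satisfies $\mathrm{sim}(u,q)\le s_K$). Assume that $C_K$ contains a diverse set of size $k$. For $1\le i\le k$, let $R_i\subseteq C_K$ be a diverse set of size $i$ with maximal total score among all diverse subsets of $C_K$ of size $i$, and let $S_i=\sum_{r\in R_i}\mathrm{sim}(r,q)$ be its total score. If $$\min_{0<i<k}\left\{\frac{S_k-S_i}{k-i}\right\}>s_K,$$ then the current solution $R_k$, with total score $S_k$, is an optimal diverse set of size $k$ for the whole dataset $V$.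
   Context: The similarity function assigns a real number $\mathrm{sim}(u,v)=\mathrm{sim}(v,u)$ to a pair of vectors; $\mathrm{sim}(v,q)$ is called the similarity score of $v$ with respect to the query $q$. A set $R\subseteq V$ is a diverse set (at level $\epsilon$) if $\mathrm{sim}(r,r')<\epsilon$ for all distinct $r,r'\in R$. The total score of $R$ is $\sum_{r\in R}\mathrm{sim}(r,q)$. An optimal diverse set of size $k$ for $V$ is a diverse set $R\subseteq V$ with $|R|=k$ whose total score is maximal among all diverse subsets of $V$ of size $k$. A minimum over an empty index set (the case $k=1$) is taken to be $+\infty$. *)

(* Defs.v *)
From mathcomp Require Import all_boot all_order all_algebra finmap.
From mathcomp Require Import constructive_ereal reals.

Set Implicit Arguments.
Unset Strict Implicit.
Unset Printing Implicit Defensive.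

Import Order.TTheory GRing.Theory Num.Theory.

Local Open Scope fset_scope.
Local Open Scope ring_scope.

Definition diverse (R : realType) (T : choiceType) (sim : T -> T -> R)
    (eps : R) (A : {fset T}) : Prop :=
  forall r r' : T, r \in A -> r' \in A -> r <> r' -> sim r r' < eps.

Definition total_score (R : realType) (T : choiceType) (sim : T -> T -> R)
    (q : T) (A : {fset T}) : R :=
  \sum_(r <- A) sim r q.

Definition diverse_subset (R : realType) (T : choiceType) (sim : T -> T -> R)
    (eps : R) (V : {fset T}) (k : nat) (A : {fset T}) : Prop :=
  [/\ A `<=` V, diverse sim eps A & #|` A| = k].

Definition optimal_diverse (R : realType) (T : choiceType) (sim : T -> T -> R)
    (q : T) (eps : R) (V : {fset T}) (k : nat) (A : {fset T}) : Prop :=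
  diverse_subset sim eps V k A /\
  forall B : {fset T}, diverse_subset sim eps V k B ->
    total_score sim q B <= total_score sim q A.

(* Neighbors are indexed from 1: only the values r 1, ..., r K matter. *)
Definition neighbor_set (T : choiceType) (r : nat -> T) (K : nat) : {fset T} :=
  [fset r i | i in iota 1 K].

Definition nearest_neighbors (R : realType) (T : choiceType)
    (sim : T -> T -> R) (q : T) (V : {fset T}) (K : nat) (r : nat -> T) : Prop :=
  [/\ forall i j : nat, (1 <= i <= K)%N -> (1 <= j <= K)%N ->
        r i = r j -> i = j,
      neighbor_set r K `<=` V,
      forall i j : nat, (1 <= i)%N -> (i <= j)%N -> (j <= K)%N ->
        sim (r j) q <= sim (r i) q
    & forall u : T, u \in V `\` neighbor_set r K -> sim u q <= sim (r K) q].

(* Main.v *)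
(* Split a diverse k-subset B of V along the set C of the K nearest neighbors,
   with i elements inside C and k - i outside. The inside part scores at most
   S_i and each outside element at most s_K, so for 0 < i < k the gap condition
   gives score B <= S_i + (k - i) s_K < S_k. The two extremes need no gap: for
   i = k, B is a competitor of R_k inside C, and for i = 0 the score of B is at
   most k s_K, while every element of R_k scores at least s_K. *)

Require Import Defs.
From mathcomp Require Import all_boot all_order all_algebra finmap.
From mathcomp Require Import constructive_ereal reals.

Set Implicit Arguments.
Unset Strict Implicit.
Unset Printing Implicit Defensive.

Import Order.TTheory GRing.Theory Num.Theory.

Local Open Scope fset_scope.
Local Open Scope ring_scope.

Lemma sumr_const_fset (V : nmodType) (T : choiceType) (A : {fset T}) (c : V) :
  \sum_(u <- A) c = c *+ #|` A|.
Proof. by rewrite big_const_seq count_predT iter_addr_0. Qed.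

Section TotalScore.
Variables (R : realType) (T : choiceType) (sim : T -> T -> R) (q : T).
Implicit Types (A B : {fset T}) (c : R).

Lemma total_score_le A c :
  {in A, forall u, sim u q <= c} -> total_score sim q A <= c *+ #|` A|.
Proof.
by move=> le_c; rewrite /total_score -sumr_const_fset !big_seq; apply: ler_sum.
Qed.

Lemma total_score_ge A c :
  {in A, forall u, c <= sim u q} -> c *+ #|` A| <= total_score sim q A.
Proof.
by move=> ge_c; rewrite /total_score -sumr_const_fset !big_seq; apply: ler_sum.
Qed.

Lemma total_scoreID A B :
  total_score sim q A =
    total_score sim q (A `&` B) + total_score sim q (A `\` B).
Proof.
rewrite /total_score (big_fsetID _ (mem B)) /=.
by congr (_ + _); apply: eq_fbigl => u; rewrite !inE //= andbC.
Qed.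

End TotalScore.

Lemma diverse_sub (R : realType) (T : choiceType) (sim : T -> T -> R)
    (eps : R) (A B : {fset T}) :
  A `<=` B -> diverse sim eps B -> diverse sim eps A.
Proof. by move=> /fsubsetP sAB divB x y /sAB xB /sAB yB; apply: divB. Qed.

(** Scores descend along the indices and stop at [K]. This bounds the score of [Rs k] from below
    when [B] misses [C]. *)
Lemma nearest_neighbors_ge (R : realType) (T : choiceType)
    (sim : T -> T -> R) (q : T) (V : {fset T}) (K : nat) (r : nat -> T) :
  nearest_neighbors sim q V K r ->
  {in neighbor_set r K, forall u, sim (r K) q <= sim u q}.
Proof.
case=> _ _ s_desc _ u /imfsetP[i /=].
by rewrite mem_iota add1n ltnS => /andP[i_ge1 i_leK] ->; apply: s_desc.
Qed.

Theorem theorem2 (R : realType) (T : choiceType) (sim : T -> T -> R)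
    (sim_sym : forall u v : T, sim u v = sim v u)
    (V : {fset T}) (q : T) (eps : R) (k : nat) (k_ge1 : (1 <= k)%N)
    (K : nat) (r : nat -> T)
    (r_knn : nearest_neighbors sim q V K r)
    (C_diverse : exists A : {fset T},
       diverse_subset sim eps (neighbor_set r K) k A)
    (Rs : nat -> {fset T})
    (Rs_opt : forall i : nat, (1 <= i <= k)%N ->
       optimal_diverse sim q eps (neighbor_set r K) i (Rs i))
    (S : nat -> R)
    (S_def : forall i : nat, (1 <= i <= k)%N ->
       S i = total_score sim q (Rs i))
    (gap : ((sim (r K) q)%:E <
       \big[Order.min/+oo]_(1 <= i < k) ((S k - S i) / (k - i)%:R)%:E)%E) :
  total_score sim q (Rs k) = S k /\ optimal_diverse sim q eps V k (Rs k).
Proof.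
have [_ sCV _ out_le] := r_knn.
have kk : (1 <= k <= k)%N by rewrite k_ge1 leqnn.
have [[sRC divR cardR] maxR] := Rs_opt k kk.
split; first by rewrite S_def.
split; first by split=> //; apply: fsubset_trans sRC sCV.
move=> B [sBV divB cardB].
set C := neighbor_set r K in sCV out_le sRC maxR *; set sK := sim (r K) q in gap out_le.
set i := #|` B `&` C|.
have i_le_k : (i <= k)%N by rewrite -cardB fsubset_leq_card // fsubsetIl.
have out_score : total_score sim q (B `\` C) <= sK *+ (k - i).
  have -> : (k - i)%N = #|` B `\` C| by rewrite cardfsD cardB.
  apply: total_score_le => u; rewrite inE => /andP[uC uB].
  by apply: out_le; rewrite inE uC (fsubsetP sBV).
have [i_ltk|i_gek] := ltnP i k; last first.
  (* The intersection of [B] and [C] has at least [k] elements, as many as [B], so it is all of [B]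
     and [B] lies inside [C]. *)
  apply: maxR; split=> //; apply/fsetIidPl/eqP.
  by rewrite eqEfcard fsubsetIl /= cardB.
rewrite (total_scoreID _ _ B C).
have [i0|i_gt0] := posnP i.
  have BC0 : B `&` C = fset0 by apply/eqP; rewrite -cardfs_eq0 -/i i0.
  rewrite BC0 {1}/total_score big_seq_fset0 add0r.
  (* Reading [k] as the cardinality of [Rs k] turns the bound into one copy of [sK] per element of
     [Rs k]. *)
  apply: le_trans out_score _; rewrite i0 subn0 -[X in sK *+ X]cardR.
  apply: total_score_ge => u uR.
  by apply: (nearest_neighbors_ge r_knn); apply: (fsubsetP sRC).
have i_range : (1 <= i <= k)%N by rewrite i_gt0 i_le_k.
have [_ maxRi] := Rs_opt i i_range.
have in_score : total_score sim q (B `&` C) <= S i.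
  rewrite S_def //; apply: maxRi; split=> //; first exact: fsubsetIr.
  exact: diverse_sub (fsubsetIl _ _) divB.
have gap_i : sK < (S k - S i) / (k - i)%:R.
  (* The minimum lives in the extended reals and is at most its [i]-th term. Its default [+oo] does
     no harm: for [k = 1] no [i] reaches this case. *)
  rewrite -lte_fin; apply: (lt_le_trans gap).
  by apply: ge_bigmin_seq; rewrite // mem_index_iota i_gt0.
rewrite -S_def //; move: gap_i; rewrite ltr_pdivlMr ?ltr0n ?subn_gt0 // mulr_natr.
(* Write [S k] as [S i + (S k - S i)]: the first term dominates the inside score, the second the
   outside score. *)
move=> /ltW gap_i; rewrite -(subrKC (S i) (S k)).
exact: lerD in_score (le_trans out_score gap_i).
Qed.
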